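(* Let $0<\delta<1$, $0<\varepsilon<1/7$, $2<\alpha<\min(\frac{2}{1-\delta},3)$ and $0<\rho<\min\!\left(\frac{1-\delta}{2},\frac{2-\alpha(1-\delta)}{4}\right)$ be constants, let $p=n^{\delta-1}$, let $H$ be a balanced graph on $m=n^{\rho}$ vertices with average degree $\alpha$ having an independent set of size $k'$, and let $k'\le k\le n-m$. Let $f$ be an arbitrary function mapping $n$-vertex graphs to $\{0,1\}$. Let $p_A=\Pr[f(G)=1]$ for $G\sim A_HG(n,p,k)$ and $p_H=\Pr[f(G)=1]$ for $G\sim G_H(n,p,k)$. Then for every constant $\beta\in[0,1)$ and all sufficiently large $n$, $p_H\ge\beta\left(p_A-\frac{4\varepsilon}{(1-\beta)^2}\right)$.
   Context: A graph with average degree $\alpha$ is balanced if every induced subgraph has average degree at most $\alpha$. $G(n,p)$ is the Erdős–Rényi random graph on vertex set $[n]$. Let $H$ have vertex set $[m]$, $m$ dividing $n$; partition $[n]$ into parts $P_i=\{(i-1)\frac nm+1,\dots,i\frac nm\}$, $1\le i\le m$. A set $S=\{v_1,\dots,v_m\}$ with $v_i\in P_i$ obeys the partition; it is an induced copy of $H$ obeying the partition in a graph $F$ if $i\mapsto v_i$ is an isomorphism from $H$ onto $F[S]$. Distribution $G_H(n,p,k)$: sample $G'\sim G(n,p)$; choose a uniformly random $M=\{v_1,\dots,v_m\}$ obeying the partition and replace $G'[M]$ by $H$ (vertex $i$ placed at $v_i$), giving $G_H$; among the vertices with no neighbor in $M$ choose a uniformly random set $I'$ of size $k-k'$ and delete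 all edges inside $I'$; if there are fewer than $k-k'$ such vertices, instead delete all edges inside a uniformly random set of $k$ vertices of $G_H$. Distribution $A_HG(n,p,k)$: sample $G'\sim G(n,p)$; choose uniformly at random one induced copy $S$ of $H$ in $G'$ obeying the partition; among the vertices with no neighbor in $S$ choose a uniformly random set of size $k-k'$ and delete all edges inside it; if no such copy exists or there are fewer than $k-k'$ such vertices, instead delete all edges inside a uniformly random set of $k$ vertices of $G'$. *)

(* Defs.v *)
From HB Require Import structures.
From mathcomp Require Import all_boot all_order all_algebra.
From mathcomp Require Import reals exp.
Set Implicit Arguments. Unset Strict Implicit. Unset Printing Implicit Defensive.
Import Order.TTheory GRing.Theory Num.Theory.
Local Open Scope ring_scope.

Definition pairs (n : nat) : {set {set 'I_n}} := [set e : {set 'I_n} | #|e| == 2%N].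
Definition is_graph (n : nat) (E : {set {set 'I_n}}) : bool := E \subset pairs n.

Definition edges_in (n : nat) (E : {set {set 'I_n}}) (U : {set 'I_n}) :=
  [set e in E | e \subset U].

Section Defs.
Variable R : realType.

Definition avg_deg_on (n : nat) (E : {set {set 'I_n}}) (U : {set 'I_n}) : R :=
  (2 * #|edges_in E U|)%:R / #|U|%:R.
Definition avg_deg (n : nat) (E : {set {set 'I_n}}) : R := avg_deg_on E setT.

Definition balanced (n : nat) (alpha : R) (E : {set {set 'I_n}}) : Prop :=
  forall U : {set 'I_n}, U != set0 -> avg_deg_on E U <= alpha.

Definition has_indep (n : nat) (E : {set {set 'I_n}}) (k : nat) : Prop :=
  exists I : {set 'I_n}, #|I| = k /\ edges_in E I = set0.

Definition gnp_w (n : nat) (p : R) (E : {set {set 'I_n}}) : R :=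
  p ^+ #|E| * (1 - p) ^+ (#|pairs n| - #|E|).

Definition del_in (n : nat) (E : {set {set 'I_n}}) (I : {set 'I_n}) :=
  E :\: edges_in E I.

Definition unif_subset (n : nat) (C : {set 'I_n}) (j : nat)
  (F : {set 'I_n} -> R) : R :=
  \sum_(I : {set 'I_n} | (I \subset C) && (#|I| == j)) F I / ('C(#|C|, j))%:R.

Definition cands (n : nat) (E : {set {set 'I_n}}) (S : {set 'I_n}) :=
  [set v | (v \notin S) && [forall u in S, [set u; v] \notin E]].

Definition plant_step (n : nat) (f : {set {set 'I_n}} -> bool)
  (E : {set {set 'I_n}}) (S : {set 'I_n}) (k k' : nat) : R :=
  if (k - k' <= #|cands E S|)%N
  then unif_subset (cands E S) (k - k') (fun I => (f (del_in E I))%:R)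
  else unif_subset setT k (fun I => (f (del_in E I))%:R).

Definition fallback_step (n : nat) (f : {set {set 'I_n}} -> bool)
  (E : {set {set 'I_n}}) (k : nat) : R :=
  unif_subset setT k (fun I => (f (del_in E I))%:R).

(* s : 'I_m -> 'I_n obeys the partition: s i lies in part P_i
   (0-indexed: vertex v lies in part v %/ (n %/ m)) *)
Definition obeys (n m : nat) (s : {ffun 'I_m -> 'I_n}) : bool :=
  [forall i, (s i %/ (n %/ m))%N == val i].

Definition image_set (n m : nat) (s : {ffun 'I_m -> 'I_n}) : {set 'I_n} :=
  [set s i | i : 'I_m].

Definition replace_H (n m : nat) (E : {set {set 'I_n}}) (s : {ffun 'I_m -> 'I_n})
  (EH : {set {set 'I_m}}) : {set {set 'I_n}} :=
  (E :\: edges_in E (image_set s)) :|: [set [set s x | x in e] | e : {set 'I_m} in EH].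

Definition induced_copy (n m : nat) (E : {set {set 'I_n}}) (EH : {set {set 'I_m}})
  (s : {ffun 'I_m -> 'I_n}) : bool :=
  obeys s && [forall i, forall j, ([set s i; s j] \in E) == ([set i; j] \in EH)].

Definition prob_GH (n m : nat) (p : R) (EH : {set {set 'I_m}}) (k k' : nat)
  (f : {set {set 'I_n}} -> bool) : R :=
  \sum_(E : {set {set 'I_n}} | is_graph E) gnp_w p E *
    \sum_(s : {ffun 'I_m -> 'I_n} | obeys s)
      (#|[set s' : {ffun 'I_m -> 'I_n} | obeys s']|%:R)^-1 *
      plant_step f (replace_H E s EH) (image_set s) k k'.

Definition prob_AHG (n m : nat) (p : R) (EH : {set {set 'I_m}}) (k k' : nat)
  (f : {set {set 'I_n}} -> bool) : R :=
  \sum_(E : {set {set 'I_n}} | is_graph E) gnp_w p E *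
    (let copies := [set s : {ffun 'I_m -> 'I_n} | induced_copy E EH s] in
     if copies != set0
     then \sum_(s in copies) (#|copies|%:R)^-1 * plant_step f E (image_set s) k k'
     else fallback_step f E k).

End Defs.

(* Main.v *)
Require Import Defs.
From HB Require Import structures.
From mathcomp Require Import all_boot all_order all_algebra.
From mathcomp Require Import reals exp.
From mathcomp Require Import ring lra zify.
Import Order.TTheory GRing.Theory Num.Theory.
Local Open Scope ring_scope.

Set Implicit Arguments.
Unset Strict Implicit.

(** Let X be the number of induced copies of H obeying the partition in G', and
mu its expectation. Planting H on a uniformly random placement is the same as
weighting G' by X / mu and then choosing a uniformly random copy, so p_H is the
expectation of X / mu times the average success over copies. On the event
X >= beta mu this dominates beta times the integrand of p_A; the complementary
event has probability at most Var X / ((1 - beta) mu)^2 by Chebyshev.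

For the variance, two placements can only meet in vertices with the same index;
if they agree on a set T of indices, both are copies with probability at most
q^2 p^(- alpha |T| / 2) (1 - p)^(- m^2), where q is the probability of a single
copy and balancedness bounds the edges of H inside T. Summing over pairs of
placements factorises over the indices and gives
E[X^2] <= mu^2 (1 + x)^m (1 - p)^(- m^2) with x = p^(- alpha / 2) m / n.
The bounds on rho say that m x and m^2 p are negative powers of n, so both are
eventually at most eps, and Bernoulli's inequality yields
E[X^2] <= mu^2 / (1 - eps)^2 <= (1 + 4 eps) mu^2. *)

(** * Random subsets with independent elements *)

(** For [E] inside [D], the probability that the [p]-random subset of [D] equals [E]. With
    [D := pairs n] it unfolds to [gnp_w]. *)
Definition bern_w {R : nzRingType} {T : finType} (p : R) (D E : {set T}) : R :=
  p ^+ #|E| * (1 - p) ^+ (#|D| - #|E|).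

Section RandomSubset.
Context {R : numDomainType} {T : finType}.
Variable p : R.
Implicit Types (A B D E : {set T}) (g : {set T} -> R).

Lemma sum_bern_w D : \sum_(E : {set T} | E \subset D) bern_w p D E = 1.
Proof.
rewrite (partition_big (fun E : {set T} => inord #|E| : 'I_#|D|.+1) xpredT) //=.
rewrite -[RHS](expr1n _ #|D|) -[X in X ^+ _](subrK p) exprDn.
apply: eq_bigr => j _.
under eq_bigr => E /andP[sED /eqP jE].
  have -> : bern_w p D E = (1 - p) ^+ (#|D| - j) * p ^+ j.
    by rewrite /bern_w -jE inordK ?ltnS ?subset_leq_card // mulrC.
  over.
rewrite sumr_const -cards_draws; congr (_ *+ _).
apply: eq_card => E; rewrite !inE unfold_in; apply: andb_id2l => sED.
by rewrite -val_eqE /= inordK // ltnS subset_leq_card.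
Qed.

(** The traces of the random set on [B] and on [D :\: B] are independent, so fixing the first to be
    [A] splits off the factor [bern_w p B A]. *)
Lemma sum_bern_w_cond D B A g : B \subset D -> A \subset B ->
  \sum_(E : {set T} | (E \subset D) && (E :&: B == A)) bern_w p D E * g E =
  bern_w p B A *
    \sum_(E : {set T} | E \subset D :\: B) bern_w p (D :\: B) E * g (E :|: A).
Proof.
move=> sBD sAB.
rewrite (reindex_onto (fun E => E :|: A) (fun E => E :\: B)); last first.
  by move=> E /andP[_ /eqP <-]; rewrite setUC setID.
rewrite mulr_sumr; apply: eq_big => [E|E].
  apply/andP/idP => [[/andP[sED _] /eqP <-]|sE].
    by rewrite setSD // (subset_trans _ sED).
  have dEB : [disjoint E & B].
    by move: sE; rewrite subsetD => /andP[].
  rewrite subUset (subset_trans sAB sBD) (subset_trans sE (subsetDl _ _)).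
  rewrite setIUl (setIidPl sAB) (disjoint_setI0 dEB) set0U eqxx; split=> //.
  rewrite setDUl (setDidPl dEB).
  by move: sAB; rewrite -setD_eq0 => /eqP ->; rewrite setU0.
case/andP => /andP[sED _] /eqP defE.
have sE : E \subset D :\: B by rewrite -defE setSD.
have dEB : [disjoint E & B] by move: sE; rewrite subsetD => /andP[].
have dEA : [disjoint E & A] by rewrite (disjointWr sAB).
rewrite mulrA; congr (_ * _); rewrite /bern_w.
have -> : #|E :|: A| = (#|E| + #|A|)%N.
  by rewrite -cardsUI (disjoint_setI0 dEA) cards0 addn0.
have := subset_leq_card sE; have := subset_leq_card sAB.
have := subset_leq_card sBD.
rewrite cardsD (setIidPr sBD) => h1 h2 h3.
have -> : (#|D| - (#|E| + #|A|) = (#|D| - #|B| - #|E|) + (#|B| - #|A|))%N by lia.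
by rewrite !exprD; ring.
Qed.

(** Conditioning the trace on [B] to be [A] has the same effect as overwriting it by [A], since the
    part outside [B] keeps its law. This is what relates planting to conditioning. *)
Lemma sum_bern_w_resample D B A g : B \subset D -> A \subset B ->
  \sum_(E : {set T} | (E \subset D) && (E :&: B == A)) bern_w p D E * g E =
  bern_w p B A * \sum_(E : {set T} | E \subset D) bern_w p D E * g ((E :\: B) :|: A).
Proof.
move=> sBD sAB; rewrite sum_bern_w_cond //; congr (_ * _).
rewrite [RHS](partition_big (fun E => E :&: B) (fun E => E \subset B)) /=; last first.
  by move=> E _; rewrite subsetIr.
under [RHS]eq_bigr => A' sA'B.
  rewrite (sum_bern_w_cond (fun E => g ((E :\: B) :|: A))) //.
  under eq_bigr => E sE.
    have -> : (E :|: A') :\: B = E.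
      have dEB : [disjoint E & B] by move: sE; rewrite subsetD => /andP[].
      rewrite setDUl (setDidPl dEB).
      by move: sA'B; rewrite -setD_eq0 => /eqP ->; rewrite setU0.
    over.
  over.
by rewrite -mulr_suml sum_bern_w mul1r.
Qed.

Lemma bern_w_prob D B A : B \subset D -> A \subset B ->
  \sum_(E : {set T} | E \subset D) bern_w p D E * (E :&: B == A)%:R = bern_w p B A.
Proof.
move=> sBD sAB.
transitivity (\sum_(E : {set T} | (E \subset D) && (E :&: B == A)) bern_w p D E * 1).
  rewrite big_mkcondr /=.
  by apply: eq_bigr => E _; case: eqP; rewrite ?mulr0 ?mulr1.
rewrite (sum_bern_w_resample (fun=> 1)) //.
by under eq_bigr do rewrite mulr1; rewrite sum_bern_w mulr1.
Qed.

(** Cardinality is modular. This expresses the weight of a union through two separate weights and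
    the weight of the overlap. *)
Lemma bern_w_setUI B1 A1 B2 A2 : A1 \subset B1 -> A2 \subset B2 ->
  bern_w p (B1 :|: B2) (A1 :|: A2) * bern_w p (B1 :&: B2) (A1 :&: A2) =
  bern_w p B1 A1 * bern_w p B2 A2.
Proof.
move=> sA1 sA2; rewrite /bern_w.
have := cardsUI A1 A2; have := cardsUI B1 B2.
have := subset_leq_card sA1; have := subset_leq_card sA2.
have := subset_leq_card (setUSS sA1 sA2); have := subset_leq_card (setISS sA1 sA2).
move=> h1 h2 h3 h4 h5 h6.
rewrite mulrACA -!exprD [RHS]mulrACA -!exprD.
by congr (_ ^+ _ * _ ^+ _); lia.
Qed.

Hypothesis p01 : 0 <= p <= 1.

Lemma bern_w_ge0 D E : 0 <= bern_w p D E.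
Proof. by case/andP: p01 => p0 p1; rewrite mulr_ge0 // exprn_ge0 // subr_ge0. Qed.

(** The two events together determine the trace on [B1 :|: B2]. Only an inequality holds: if [A1]
    and [A2] disagree on [B1 :&: B2], the left side vanishes. *)
Lemma bern_w_joint_le D B1 A1 B2 A2 : B1 \subset D -> A1 \subset B1 ->
    B2 \subset D -> A2 \subset B2 ->
  \sum_(E : {set T} | E \subset D)
     bern_w p D E * ((E :&: B1 == A1)%:R * (E :&: B2 == A2)%:R)
  <= bern_w p (B1 :|: B2) (A1 :|: A2).
Proof.
move=> sB1 sA1 sB2 sA2.
rewrite -(bern_w_prob (D := D)); [|by rewrite subUset sB1|exact: setUSS].
apply: ler_sum => E _; rewrite ler_wpM2l ?bern_w_ge0 //.
have [<-|_] := eqVneq (E :&: B1) A1; last by rewrite mul0r ler0n.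
have [<-|_] := eqVneq (E :&: B2) A2; last by rewrite mulr0 ler0n.
by rewrite setIUr eqxx mulr1.
Qed.

End RandomSubset.

(** * Placements obeying the partition *)

Definition pairs_in {n : nat} (U : {set 'I_n}) : {set {set 'I_n}} := edges_in (pairs n) U.

Definition map_edges {n m : nat} (s : {ffun 'I_m -> 'I_n}) (EH : {set {set 'I_m}}) :=
  [set [set s x | x in e] | e : {set 'I_m} in EH].

Definition agree {n m : nat} (s t : {ffun 'I_m -> 'I_n}) : {set 'I_m} :=
  [set i | s i == t i].

Section Embeddings.
Variables n m : nat.
Implicit Types (s t : {ffun 'I_m -> 'I_n}) (EH : {set {set 'I_m}}) (E : {set {set 'I_n}}).

(** A vertex lies in one part only, so its part reveals its index. *)
Lemma obeys_eq s t i j : obeys s -> obeys t -> s i = t j -> i = j.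
Proof.
move=> /forallP/(_ i)/eqP si /forallP/(_ j)/eqP tj st.
by apply: val_inj; rewrite /= -si -tj st.
Qed.

Lemma obeys_inj s : obeys s -> injective s.
Proof. by move=> os i j; apply: obeys_eq. Qed.

Lemma pairs_in_image s : injective s -> pairs_in (image_set s) = map_edges s (pairs m).
Proof.
move=> injs; apply/setP => e; rewrite !inE; apply/idP/imsetP => [/andP[e2 se]|[e0]].
  have eE : e = s @: (s @^-1: e).
    apply/setP => x; apply/idP/imsetP => [xe|[y]]; last by rewrite inE => ye ->.
    have /imsetP[y _ xE] := subsetP se _ xe.
    by exists y => //; rewrite inE -xE.
  by exists (s @^-1: e) => //; rewrite inE -(card_imset _ injs) -eE.
rewrite inE => e2 ->; rewrite card_imset // e2 /=.
by apply/subsetP => _ /imsetP[x _ ->]; apply: imset_f.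
Qed.

Lemma map_edgesS s EH EH' : EH \subset EH' -> map_edges s EH \subset map_edges s EH'.
Proof. exact: imsetS. Qed.

Lemma card_map_edges s EH : injective s -> #|map_edges s EH| = #|EH|.
Proof. by move=> injs; rewrite card_imset //; apply: imset_inj. Qed.

Lemma map_edges_pairs_in s EH : injective s -> is_graph EH ->
  map_edges s EH \subset pairs_in (image_set s).
Proof. by move=> injs gEH; rewrite pairs_in_image // map_edgesS. Qed.

Lemma card_pairs_in_image s : injective s -> #|pairs_in (image_set s)| = #|pairs m|.
Proof. by move=> injs; rewrite pairs_in_image // card_map_edges. Qed.

Lemma card_pairs_le : (#|pairs m| <= m ^ 2)%N.
Proof.
rewrite card_draws card_ord; case: m => [//|k].
by rewrite bin2; lia.
Qed.

Lemma edges_in_graph E U : is_graph E -> edges_in E U = E :&: pairs_in U.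
Proof.
move=> gE; apply/setP => e; rewrite !inE.
by have [eE|//] := boolP (e \in E); have := subsetP gE _ eE; rewrite inE => ->.
Qed.

(** Being an induced copy becomes an event about the trace of [E] on a fixed set of pairs, the form
    used by the random subset lemmas. *)
Lemma induced_copyE EH E s : is_graph EH -> is_graph E -> obeys s ->
  induced_copy E EH s = (E :&: pairs_in (image_set s) == map_edges s EH).
Proof.
move=> gEH gE os; have injs := obeys_inj os.
have inj2 := imset_inj injs.
rewrite /induced_copy os /=; apply/forallP/eqP => [copy|copyE i].
  rewrite pairs_in_image //; apply/setP => e; rewrite inE.
  apply/andP/imsetP => [[eE /imsetP[e0 e0m defe]]|[e0 e0H ->]].
    exists e0 => //; move: e0m; rewrite inE => /cards2P[i [j [_ e0E]]].
    move: (copy i) => /forallP/(_ j)/eqP; rewrite -e0E => <-.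
    by rewrite -imset_set1 -[in [set s j]]imset_set1 -imsetU -e0E -defe.
  have e0m := subsetP gEH _ e0H; split; last by rewrite mem_imset.
  move: e0m; rewrite inE => /cards2P[i [j [_ e0E]]].
  move: (copy i) => /forallP/(_ j)/eqP; rewrite -e0E => copyij.
  by rewrite e0E imsetU !imset_set1 copyij.
apply/forallP => j; apply/eqP.
have -> : [set s i; s j] = s @: [set i; j] by rewrite imsetU !imset_set1.
have -> : ([set i; j] \in EH) = (s @: [set i; j] \in map_edges s EH).
  by rewrite mem_imset.
rewrite -copyE inE pairs_in_image //.
(* This also settles [i = j]: members of the graph [E] have two elements. *)
have [sE|//] := boolP (_ \in E); rewrite mem_imset // inE.
by have := subsetP gE _ sE; rewrite inE card_imset.
Qed.

Lemma replace_HE EH E s : is_graph E ->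
  replace_H E s EH = (E :\: pairs_in (image_set s)) :|: map_edges s EH.
Proof.
move=> gE; rewrite /replace_H edges_in_graph //; congr (_ :|: _).
by rewrite setDIr setDv set0U.
Qed.

(** Both placements send each endpoint of a shared edge to the same vertex, hence from the same
    index. *)
Lemma card_map_edgesI_le EH s t : obeys s -> obeys t ->
  (#|map_edges s EH :&: map_edges t EH| <= #|edges_in EH (agree s t)|)%N.
Proof.
move=> os ot; have injs := obeys_inj os.
rewrite -(card_map_edges _ (s := s)) //; apply: subset_leq_card; apply/subsetP => e.
rewrite inE => /andP[/imsetP[e1 e1H ->] /imsetP[e2 e2H ee]].
rewrite mem_imset; last exact: imset_inj.
rewrite inE e1H /=; apply/subsetP => x xe; rewrite inE.
have : s x \in t @: e2 by rewrite -ee mem_imset.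
by case/imsetP => y ye sx; rewrite {1}sx (obeys_eq os ot sx).
Qed.

Lemma card_part (i : 'I_m) : (m %| n)%N ->
  #|[pred a : 'I_n | (a %/ (n %/ m))%N == i]| = (n %/ m)%N.
Proof.
move=> mn; set d := (n %/ m)%N.
have nE : n = (m * d)%N by rewrite mulnC divnK.
have lt_n (j : 'I_d) : (i * d + j < n)%N.
  rewrite nE (leq_trans (n := i.+1 * d)) ?leq_mul2r ?ltn_ord ?orbT //.
  by rewrite mulSn addnC ltn_add2r.
have inj_h : injective (fun j : 'I_d => Ordinal (lt_n j)).
  by move=> j1 j2 /(congr1 val) /= /addnI /val_inj.
rewrite -[RHS]card_ord -(card_codom inj_h); apply: eq_card => a.
rewrite !inE; apply/eqP/codomP => [ai|[j ->] /=].
  have d0 : (0 < d)%N.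
    by have := leq_ltn_trans (leq0n a) (ltn_ord a);
       rewrite [X in (_ < X)%N -> _]nE muln_gt0 => /andP[].
  exists (Ordinal (ltn_pmod a d0)); apply: val_inj.
  by rewrite /= -ai -divn_eq.
have d0 : (0 < d)%N by apply: leq_ltn_trans (ltn_ord j).
by rewrite divnMDl // divn_small // addn0.
Qed.

(** Viewing placements as a product of parts lets counts and sums factor over the indices. *)
Lemma obeys_family (s : {ffun 'I_m -> 'I_n}) :
  obeys s = (s \in family (fun i : 'I_m => [pred a : 'I_n | (a %/ (n %/ m))%N == i])).
Proof. by []. Qed.

Lemma card_obeys : (m %| n)%N ->
  #|[set s : {ffun 'I_m -> 'I_n} | obeys s]| = ((n %/ m) ^ m)%N.
Proof.
move=> mn; rewrite cardsE (eq_card obeys_family) card_family.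
rewrite foldrE big_map big_enum /=.
by under eq_bigr do rewrite card_part //; rewrite prod_nat_const card_ord.
Qed.

(** Each index contributes independently: one vertex of its part agrees with [s] and gives [y], each
    of the others gives 1. *)
Lemma sum_exp_agree (R : comNzRingType) (y : R) s : (m %| n)%N -> obeys s ->
  \sum_(t : {ffun 'I_m -> 'I_n} | obeys t) y ^+ #|agree s t| =
  ((n %/ m)%:R - 1 + y) ^+ m.
Proof.
move=> mn os.
have part_sum (i : 'I_m) : \sum_(a : 'I_n | (a %/ (n %/ m))%N == i) (if s i == a then y else 1)
    = (n %/ m)%:R - 1 + y.
  have osi : (s i %/ (n %/ m))%N == i by move/forallP: os; apply.
  rewrite -[in RHS](card_part i) // -sumr_const.
  rewrite (bigD1 (s i)) //= eqxx [in RHS](bigD1 (s i)) //=.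
  rewrite [X in y + X](eq_bigr (fun=> 1)); first by rewrite (addrC 1) addrK addrC.
  by move=> a /andP[_ /negPf]; rewrite eq_sym => ->.
transitivity (\prod_(i < m) \sum_(a : 'I_n | (a %/ (n %/ m))%N == i)
    (if s i == a then y else 1)); last first.
  by rewrite (eq_bigr _ (fun i _ => part_sum i)) prodr_const card_ord.
rewrite bigA_distr_big_dep; apply: eq_big => [t|t _]; first by rewrite obeys_family.
rewrite -big_mkcond /= prodr_const; congr (_ ^+ _).
by apply: eq_card => i; rewrite !inE.
Qed.

End Embeddings.

(** * Moments of the number of copies *)

Lemma bernoulli_le (R : realDomainType) (x : R) (j : nat) :
  0 <= x <= 1 -> 1 - j%:R * x <= (1 - x) ^+ j.
Proof.
move=> /andP[x0 x1]; elim: j => [|j IH]; first by rewrite mul0r subr0.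
rewrite exprS; apply: (le_trans _ (ler_wpM2l _ IH)); last by rewrite subr_ge0.
have : 0 <= j%:R * x * x by rewrite !mulr_ge0.
by rewrite -natr1; nra.
Qed.

(** * Deletion steps as probabilities *)

Section Steps.
Variables (R : realType) (n : nat).

Lemma unif_subset_bool01 (C : {set 'I_n}) (j : nat) (F : {set 'I_n} -> bool) :
  0 <= unif_subset C j (fun I => (F I)%:R : R) <= 1.
Proof.
rewrite /unif_subset; apply/andP; split; first by rewrite sumr_ge0 // => I _; rewrite divr_ge0.
rewrite -mulr_suml.
(* If [C] has no subset of size [j], the weight is the inverse of zero, which is 0. *)
have [->|C0] := eqVneq 'C(#|C|, j) 0%N; first by rewrite invr0 mulr0.
rewrite ler_pdivrMr ?ltr0n ?lt0n // mul1r -cards_draws -sum1_card natr_sum.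
rewrite [leRHS](eq_bigl (fun I : {set 'I_n} => (I \subset C) && (#|I| == j))); last first.
  by move=> I; rewrite inE.
by apply: ler_sum => I _; case: (F I).
Qed.

Lemma plant_step01 (f : {set {set 'I_n}} -> bool) E S k k' :
  0 <= plant_step R f E S k k' <= 1.
Proof. by rewrite /plant_step; case: ifP => _; apply: unif_subset_bool01. Qed.

Lemma fallback_step01 (f : {set {set 'I_n}} -> bool) E k :
  0 <= fallback_step R f E k <= 1.
Proof. exact: unif_subset_bool01. Qed.

End Steps.

Definition copies {n m : nat} (EH : {set {set 'I_m}}) (E : {set {set 'I_n}}) :=
  [set s : {ffun 'I_m -> 'I_n} | induced_copy E EH s].

Section Moments.
Variables (R : realType) (n m : nat) (p : R) (EH : {set {set 'I_m}}).
Hypotheses (p01 : 0 < p < 1) (gEH : is_graph EH).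
Implicit Types (s t : {ffun 'I_m -> 'I_n}) (E : {set {set 'I_n}}).

Let p0 : 0 < p. Proof. by case/andP: p01. Qed.
Let p1 : p < 1. Proof. by case/andP: p01. Qed.
Let p01W : 0 <= p <= 1. Proof. by rewrite !ltW. Qed.

Definition copy_prob : R := bern_w p (pairs m) EH.

Definition mean_copies : R :=
  #|[set s : {ffun 'I_m -> 'I_n} | obeys s]|%:R * copy_prob.

Lemma copy_prob_gt0 : 0 < copy_prob.
Proof. by rewrite mulr_gt0 // exprn_gt0 // subr_gt0. Qed.

Lemma gnp_w_ge0 E : 0 <= gnp_w p E.
Proof. exact: bern_w_ge0. Qed.

Lemma sum_gnp_w : \sum_(E : {set {set 'I_n}} | is_graph E) gnp_w p E = 1.
Proof. exact: sum_bern_w. Qed.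

Lemma pairs_inS (U : {set 'I_n}) : pairs_in U \subset pairs n.
Proof. by apply/subsetP => e; rewrite inE => /andP[]. Qed.

Lemma bern_w_map_edges s : obeys s ->
  bern_w p (pairs_in (image_set s)) (map_edges s EH) = copy_prob.
Proof.
move=> os; have injs := obeys_inj os.
by rewrite /bern_w card_pairs_in_image // card_map_edges.
Qed.

(** Indicators replace the random index set by a fixed one, so that this sum can be exchanged with
    the sum over graphs. *)
Lemma sum_copies E (F : {ffun 'I_m -> 'I_n} -> R) : is_graph E ->
  \sum_(s in copies EH E) F s =
  \sum_(s | obeys s) (E :&: pairs_in (image_set s) == map_edges s EH)%:R * F s.
Proof.
move=> gE; rewrite [RHS](eq_bigr (fun s => if induced_copy E EH s then F s else 0)).
  rewrite -big_mkcondr /=; apply: eq_bigl => s; rewrite inE.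
  by rewrite /induced_copy andbA andbb.
by move=> s os; rewrite induced_copyE //; case: eqP; rewrite ?mul1r ?mul0r.
Qed.

Lemma card_copiesE E : is_graph E ->
  #|copies EH E|%:R =
  \sum_(s | obeys s) (E :&: pairs_in (image_set s) == map_edges s EH)%:R :> R.
Proof.
move=> gE; rewrite -sum1_card natr_sum sum_copies //.
by under eq_bigr do rewrite mulr1.
Qed.

(* Conditioning on [s] being an induced copy has the law of planting [EH] on [s]. *)
Lemma prob_GHE (k k' : nat) (f : {set {set 'I_n}} -> bool) :
  prob_GH p EH k k' f =
  \sum_(E | is_graph E) gnp_w p E *
    \sum_(s in copies EH E) mean_copies^-1 * plant_step R f E (image_set s) k k'.
Proof.
rewrite /prob_GH; under eq_bigr do rewrite mulr_sumr.
under [RHS]eq_bigr => E gE do rewrite sum_copies // mulr_sumr.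
rewrite exchange_big [RHS]exchange_big /=; apply: eq_bigr => s os.
have injs := obeys_inj os.
pose g E := plant_step R f E (image_set s) k k'.
have sBD := pairs_inS (image_set s); have sAB := map_edges_pairs_in injs gEH.
have := sum_bern_w_resample p g sBD sAB.
rewrite bern_w_map_edges // => resample.
transitivity (#|[set s' : {ffun 'I_m -> 'I_n} | obeys s']|%:R^-1 *
  \sum_(E : {set {set 'I_n}} | E \subset pairs n) bern_w p (pairs n) E *
     g ((E :\: pairs_in (image_set s)) :|: map_edges s EH)).
  rewrite mulr_sumr; apply: eq_bigr => E gE.
  by rewrite replace_HE // mulrCA.
transitivity (mean_copies^-1 * \sum_(E : {set {set 'I_n}} |
     (E \subset pairs n) && (E :&: pairs_in (image_set s) == map_edges s EH))
       bern_w p (pairs n) E * g E).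
  (* Since [mean_copies] is the number of placements times [copy_prob], the factor [copy_prob] from
     resampling cancels. *)
  by rewrite resample /mean_copies invfM mulrA mulfVK ?gt_eqF ?copy_prob_gt0.
rewrite big_mkcondr mulr_sumr; apply: eq_bigr => E gE.
by case: eqP => _; rewrite ?mul1r ?mul0r ?mulr0 // mulrCA.
Qed.

Lemma first_moment :
  \sum_(E : {set {set 'I_n}} | is_graph E) gnp_w p E * #|copies EH E|%:R = mean_copies.
Proof.
under eq_bigr => E gE do rewrite card_copiesE // mulr_sumr.
rewrite exchange_big /= /mean_copies cardsE -sum1_card natr_sum mulr_suml.
apply: eq_bigr => s os; have injs := obeys_inj os.
rewrite mul1r -(bern_w_map_edges os) -(bern_w_prob p (D := pairs n)) //.
  exact: pairs_inS.
exact: map_edges_pairs_in.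
Qed.

(** * Second moment for balanced graphs *)

Variable alpha : R.
Hypothesis balEH : balanced alpha EH.

Lemma card_edges_in_le (U : {set 'I_m}) :
  #|edges_in EH U|%:R <= alpha / 2 * #|U|%:R.
Proof.
(* Balancedness speaks of nonempty sets; the empty set contains no pair. *)
have [->|U0] := eqVneq U set0.
  rewrite cards0 mulr0 (_ : edges_in EH set0 = set0) ?cards0 //.
  apply/setP => e; rewrite !inE; apply/negP => /andP[eH].
  rewrite subset0 => /eqP e0; have := subsetP gEH _ eH.
  by rewrite inE e0 cards0.
have := balEH U0; rewrite /avg_deg_on ler_pdivrMr; last by rewrite ltr0n card_gt0.
by rewrite natrM; lra.
Qed.

Let z := p `^ (alpha / 2).

Let z0 : 0 < z. Proof. exact: powR_gt0. Qed.

(** The joint probability is at most [copy_prob ^+ 2] divided by the weight of the overlap. With [T]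
    the agreement set, that weight is at least [z ^+ #|T|] for the shared edges times
    [(1 - p) ^+ (m ^ 2)] for the shared non-edges. *)
Lemma joint_copies_le s t : obeys s -> obeys t ->
  (\sum_(E : {set {set 'I_n}} | is_graph E) gnp_w p E *
    ((E :&: pairs_in (image_set s) == map_edges s EH)%:R *
     (E :&: pairs_in (image_set t) == map_edges t EH)%:R)) * (1 - p) ^+ (m ^ 2)
  <= copy_prob ^+ 2 * z^-1 ^+ #|agree s t|.
Proof.
move=> os ot; have injs := obeys_inj os; have injt := obeys_inj ot.
have sA := map_edges_pairs_in injs gEH; have tA := map_edges_pairs_in injt gEH.
have := bern_w_joint_le p01W (pairs_inS _) sA (pairs_inS _) tA.
have := bern_w_setUI p sA tA.
rewrite !bern_w_map_edges // -expr2 => <- joint.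
rewrite exprVn ler_pdivlMr ?exprn_gt0 // -mulrA.
apply: (ler_pM _ _ joint); rewrite ?sumr_ge0 //.
- by move=> E _; apply: mulr_ge0; [exact: bern_w_ge0 | rewrite mulr_ge0].
- by rewrite mulr_ge0 // exprn_ge0 ?subr_ge0 // ltW.
have z0W := ltW z0; have p0W := ltW p0; have p1W := ltW p1.
have q0W : 0 <= 1 - p by rewrite subr_ge0.
rewrite mulrC /bern_w; apply: ler_pM; rewrite ?exprn_ge0 //.
  rewrite -!powR_mulrn // /z -powRrM.
  (* As [p <= 1], an upper bound on the number of shared edges gives a lower bound on the power. *)
  apply: ger_powR; first by rewrite p0 p1W.
  apply: le_trans (card_edges_in_le _).
  by rewrite ler_nat card_map_edgesI_le.
apply: ler_wiXn2l; rewrite // ?gerBl //.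
apply: leq_trans (leq_subr _ _) _.
apply: leq_trans (subset_leq_card (subsetIl _ _)) _.
by rewrite card_pairs_in_image // card_pairs_le.
Qed.

(** The square is a sum over ordered pairs of placements; for fixed [s] the bounds over [t] add up
    to a value independent of [s]. *)
Lemma second_moment_le : (m %| n)%N ->
  (\sum_(E : {set {set 'I_n}} | is_graph E) gnp_w p E * #|copies EH E|%:R ^+ 2)
     * (1 - p) ^+ (m ^ 2)
  <= mean_copies * copy_prob * ((n %/ m)%:R - 1 + z^-1) ^+ m.
Proof.
move=> mn.
under eq_bigr => E gE.
  rewrite card_copiesE // expr2 mulr_suml mulr_sumr.
  under eq_bigr do rewrite mulr_sumr mulr_sumr.
  over.
rewrite exchange_big mulr_suml /mean_copies cardsE -sum1_card natr_sum !mulr_suml.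
apply: ler_sum => s os.
rewrite exchange_big mulr_suml mul1r -expr2 -(sum_exp_agree _ mn os) mulr_sumr.
by apply: ler_sum => t ot; apply: joint_copies_le.
Qed.

Lemma variance_copies :
  \sum_(E : {set {set 'I_n}} | is_graph E)
     gnp_w p E * (#|copies EH E|%:R - mean_copies) ^+ 2 =
  \sum_(E : {set {set 'I_n}} | is_graph E) gnp_w p E * #|copies EH E|%:R ^+ 2
  - mean_copies ^+ 2.
Proof.
under eq_bigr do rewrite sqrrB mulrDr mulrBr.
rewrite big_split sumrB /= -mulr_suml sum_gnp_w mul1r.
have -> : \sum_(E : {set {set 'I_n}} | is_graph E)
    gnp_w p E * (#|copies EH E|%:R * mean_copies *+ 2) = mean_copies * mean_copies *+ 2.
  rewrite -[X in _ = X * _ *+ 2]first_moment mulr_suml -sumrMnl.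
  by apply: eq_bigr => E _; rewrite mulrnAr mulrA.
by rewrite expr2; ring.
Qed.

End Moments.

(** * Comparison of the two distributions *)

Section Comparison.
Variables (R : realType) (n m : nat) (p : R) (EH : {set {set 'I_m}}).
Hypotheses (p01 : 0 < p < 1) (gEH : is_graph EH) (mn : (m %| n)%N) (n0 : (0 < n)%N).

Let mu := mean_copies n p EH.

Lemma mean_copiesE : mu = ((n %/ m) ^ m)%:R * copy_prob p EH.
Proof. by rewrite /mu /mean_copies card_obeys. Qed.

Lemma div_gt0_dvdn : (0 < n %/ m)%N.
Proof. by rewrite divn_gt0 ?(dvdn_gt0 n0 mn) // dvdn_leq. Qed.

Lemma mean_copies_gt0 : 0 < mu.
Proof. by rewrite mean_copiesE mulr_gt0 ?copy_prob_gt0 // ltr0n expn_gt0 div_gt0_dvdn. Qed.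

(** Chebyshev is applied pointwise: the squared deviation is kept inside the sum over graphs, and
    the two sides are compared graph by graph. *)
Lemma prob_GH_ge (k k' : nat) (f : {set {set 'I_n}} -> bool) (beta v : R) :
  0 <= beta < 1 ->
  \sum_(E : {set {set 'I_n}} | is_graph E)
     gnp_w p E * (#|copies EH E|%:R - mu) ^+ 2 <= v * mu ^+ 2 ->
  beta * (prob_AHG p EH k k' f - v / (1 - beta) ^+ 2) <= prob_GH p EH k k' f.
Proof.
move=> /andP[b0 b1] var; have mu0 := mean_copies_gt0.
have c0 : 0 < (1 - beta) ^+ 2 * mu ^+ 2 by rewrite mulr_gt0 ?exprn_gt0 ?subr_gt0.
have vE : (\sum_(E : {set {set 'I_n}} | is_graph E)
     gnp_w p E * (#|copies EH E|%:R - mu) ^+ 2) / ((1 - beta) ^+ 2 * mu ^+ 2)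
   <= v / (1 - beta) ^+ 2.
  rewrite ler_pdivrMr //; apply: le_trans var _.
  by rewrite [leRHS]mulrA divfK // expf_neq0 // subr_eq0 gt_eqF.
apply: le_trans (ler_wpM2l b0 (lerB (lexx _) vE)) _.
rewrite /prob_AHG mulr_suml -sumrB mulr_sumr prob_GHE //.
apply: ler_sum => E gE; rewrite -[in X in _ - X]mulrA -mulrBr mulrCA.
apply: ler_wpM2l; first exact: gnp_w_ge0.
rewrite -/(copies EH E) -mulr_sumr -/mu.
set X := #|copies EH E|; set S := \sum_(s in copies EH E) _.
have S0 : 0 <= S.
  by apply: sumr_ge0 => s _; case/andP: (plant_step01 R f E (image_set s) k k').
have SX : S <= X%:R.
  rewrite /X -sum1_card natr_sum; apply: ler_sum => s _.
  by case/andP: (plant_step01 R f E (image_set s) k k').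
rewrite -mulr_sumr -/S.
have aE : (if copies EH E != set0 then X%:R^-1 * S else fallback_step R f E k) <= 1.
  case: ifPn => [C0|_]; last by case/andP: (fallback_step01 R f E k).
  by rewrite mulrC ler_pdivrMr ?mul1r // ltr0n card_gt0.
have [le_bmu|lt_bmu] := lerP (beta * mu) X%:R; last first.
  (* With few copies the normalised squared deviation is at least 1, hence exceeds the success
     probability, and the left summand is nonpositive. *)
  apply: (@le_trans _ _ 0); last by rewrite mulr_ge0 // invr_ge0 ltW.
  apply: mulr_ge0_le0 => //; rewrite subr_le0; apply: le_trans aE _.
  rewrite ler_pdivlMr // mul1r -exprMn -[leRHS]sqrrN opprB ler_sqr ?nnegrE.
  - by move: lt_bmu; lra.
  - by rewrite mulr_ge0 ?subr_ge0 // ltW.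
  - by rewrite subr_ge0 (le_trans (ltW lt_bmu)) // ler_piMl // ltW.
have Y0 : 0 <= (X%:R - mu) ^+ 2 / ((1 - beta) ^+ 2 * mu ^+ 2).
  by rewrite divr_ge0 ?sqr_ge0 // ltW.
apply: (@le_trans _ _ (beta * (if copies EH E != set0 then X%:R^-1 * S
    else fallback_step R f E k))).
  by rewrite ler_wpM2l // gerBl.
case: ifPn => [C0|/negPn/eqP C0].
  have X0 : 0 < X%:R :> R by rewrite ltr0n card_gt0.
  rewrite mulrA ler_wpM2r // ler_pdivrMr // ler_pdivlMl //.
  by rewrite mulrC.
(* Without copies, this case forces [beta = 0], which removes the fallback term. *)
have bmu0 : beta * mu <= 0 by rewrite (le_trans le_bmu) // /X C0 cards0.
have -> : beta = 0.
  by apply/eqP; rewrite eq_le b0 andbT -(pmulr_lle0 _ mu0).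
by rewrite mul0r mulr_ge0 // invr_ge0 ltW.
Qed.

Lemma variance_copies_le (alpha eps : R) : (0 < m)%N -> balanced alpha EH ->
  0 < eps < 7^-1 ->
  (m ^ 2)%:R * p <= eps ->
  m%:R * ((p `^ (alpha / 2))^-1 / (n %/ m)%:R) <= eps ->
  \sum_(E : {set {set 'I_n}} | is_graph E)
     gnp_w p E * (#|copies EH E|%:R - mu) ^+ 2 <= (4 * eps) * mu ^+ 2.
Proof.
move=> m0 balEH /andP[e0 e7] mp mv; have [p0 p1] := andP p01.
have mu0 := mean_copies_gt0.
rewrite variance_copies // -/mu lerBlDr.
have := second_moment_le p01 gEH balEH mn; rewrite -/mu.
set Q := (X in X * _ <= _); set y := _^-1.
have d0 : 0 < (n %/ m)%:R :> R by rewrite ltr0n div_gt0_dvdn.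
set d := (n %/ m)%:R in d0 mv *; set x := y / d in mv.
have y0 : 0 <= y by rewrite invr_ge0 powR_ge0.
have x0 : 0 <= x by rewrite divr_ge0 // ltW.
have m1 : 1 <= m%:R :> R by rewrite ler1n.
have x1 : x <= 1 by nra.
have Q0 : 0 <= Q.
  by apply: sumr_ge0 => E _; rewrite mulr_ge0 ?gnp_w_ge0 ?exprn_ge0.
(* Here [mu = d ^ m * copy_prob], and [d - 1 + y] is at most [d + y = d * (1 + x)]. *)
have le_exp : mu * copy_prob p EH * (d - 1 + y) ^+ m <= mu ^+ 2 * (1 + x) ^+ m.
  have -> : mu ^+ 2 * (1 + x) ^+ m = mu * copy_prob p EH * (d * (1 + x)) ^+ m.
    by rewrite [(d * _) ^+ _]exprMn expr2 {2}mean_copiesE natrX -/d; ring.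
  have q0 := copy_prob_gt0 EH p01.
  apply: ler_wpM2l; first by rewrite ltW // mulr_gt0.
  have d1 : 1 <= d by rewrite ler1n div_gt0_dvdn.
  have dx : d * (1 + x) = d + y by rewrite mulrDr mulr1 /x mulrCA divff ?mulr1 // gt_eqF.
  by apply: lerXn2r; rewrite ?nnegrE ?dx; lra.
move=> secm.
have b1 : 1 - eps <= (1 - p) ^+ (m ^ 2).
  have p01W : 0 <= p <= 1 by rewrite !ltW.
  by apply: le_trans (bernoulli_le _ p01W); lra.
(* Bernoulli gives [1 - eps <= (1 - x) ^+ m], and [(1 + x) * (1 - x) <= 1]. *)
have b2 : (1 + x) ^+ m * (1 - eps) <= 1.
  have xm0 : 0 <= (1 + x) ^+ m by rewrite exprn_ge0 // addr_ge0.
  apply: (@le_trans _ _ ((1 + x) ^+ m * (1 - x) ^+ m)).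
    rewrite ler_wpM2l //.
    have x01 : 0 <= x <= 1 by rewrite x0.
    by apply: le_trans (bernoulli_le _ x01); lra.
  rewrite -exprMn exprn_ile1 //; nra.
have le1 : Q * (1 - eps) <= mu ^+ 2 * (1 + x) ^+ m.
  by apply: le_trans (ler_wpM2l Q0 b1) (le_trans secm le_exp).
have le2 : Q * (1 - eps) ^+ 2 <= mu ^+ 2.
  rewrite expr2 mulrA; apply: (@le_trans _ _ (mu ^+ 2 * (1 + x) ^+ m * (1 - eps))).
    by rewrite ler_wpM2r //; lra.
  by rewrite -mulrA ler_piMr // sqr_ge0.
(* The product equals [1 + eps * (2 - 7 * eps) + 4 * eps ^+ 3]; the bound on [eps] makes the middle
   term nonnegative. *)
have num : 1 <= (1 + 4 * eps) * (1 - eps) ^+ 2.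
  have : 0 <= eps * (2 - 7 * eps) by rewrite mulr_ge0 //; lra.
  have : 0 <= eps ^+ 3 by rewrite exprn_ge0 // ltW.
  by rewrite !exprS expr0; lra.
have e1 : 0 < (1 - eps) ^+ 2 by rewrite exprn_gt0 //; lra.
rewrite -(ler_pM2r e1); apply: le_trans le2 _.
rewrite -[X in X * (1 - eps) ^+ 2](_ : (1 + 4 * eps) * mu ^+ 2 = _); last by ring.
by rewrite mulrAC ler_peMl // sqr_ge0.
Qed.

End Comparison.

(** * Asymptotics in n and conclusion *)

Lemma natr_powRN_le_near (R : realType) (a e : R) : 0 < a -> 0 < e ->
  (* The threshold below is [e] to the power [- 1 / a], beyond which [n] to the power [a] is at
     least [1 / e]. *)
  exists N : nat, forall n : nat, (N <= n)%N -> (0 < n)%N /\ n%:R `^ (- a) <= e.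
Proof.
move=> a0 e0; exists (Num.truncn (e `^ (- a^-1))).+1 => n Nn.
have n0 : (0 < n)%N by apply: leq_trans Nn.
split=> //.
have : e `^ (- a^-1) <= n%:R.
  by apply: le_trans (ltW (truncnS_gt _)) _; rewrite ler_nat.
move=> /(ge0_ler_powR (ltW a0)); rewrite !nnegrE powR_ge0 ler0n => /(_ isT isT).
have e0W := ltW e0.
rewrite -powRrM mulNr mulVf ?gt_eqF // powR_inv1 ?(ltW e0) // powRN => le_e.
by rewrite -[leRHS]invrK lef_pV2 ?posrE ?invr_gt0 // powR_gt0 // ltr0n.
Qed.

Unset Implicit Arguments.
Set Strict Implicit.

Theorem theoremC2 (R : realType) (delta eps alpha rho beta : R) :
  0 < delta < 1 ->
  0 < eps < 7^-1 ->
  2 < alpha -> alpha < 2 / (1 - delta) -> alpha < 3 ->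
  0 < rho -> rho < (1 - delta) / 2 -> rho < (2 - alpha * (1 - delta)) / 4 ->
  0 <= beta < 1 ->
  exists N : nat, forall n : nat, (N <= n)%N ->
  forall (m : nat) (EH : {set {set 'I_m}}) (k' k : nat)
         (f : {set {set 'I_n}} -> bool),
    m%:R = n%:R `^ rho ->
    (m %| n)%N ->
    is_graph EH ->
    balanced alpha EH ->
    avg_deg R EH = alpha ->
    has_indep EH k' ->
    (k' <= k)%N -> (k <= n - m)%N ->
    let p := n%:R `^ (delta - 1) in
    prob_GH p EH k k' f >=
      beta * (prob_AHG p EH k k' f - 4 * eps / (1 - beta) ^+ 2).
Proof.
move=> /andP[d0 d1] e07 a2 _ _ _ rho1 rho2 b01; have [e0 e7] := andP e07.
(* The two conditions on [rho] say that [m ^ 2 * p] and [m * x] are powers of [n] with the negatives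
   of these two exponents. *)
have a10 : 0 < 1 - delta - 2 * rho by lra.
have a20 : 0 < 1 - alpha * (1 - delta) / 2 - 2 * rho by lra.
have [N1 HN1] := natr_powRN_le_near a10 e0.
have [N2 HN2] := natr_powRN_le_near a20 e0.
(* Starting at 2 makes [p < 1] strict. *)
exists (maxn 2 (maxn N1 N2)) => n; rewrite !geq_max => /and3P[n2 /HN1[n0 le1] /HN2[_ le2]].
move=> m EH k' k f mE mn gEH balEH _ _ _ _; lazy zeta.
set p := n%:R `^ (delta - 1).
have nR0 : n%:R != 0 :> R by rewrite pnatr_eq0 -lt0n.
have nRge0 : 0 <= n%:R :> R by [].
have p01 : 0 < p < 1.
  rewrite powR_gt0 ?ltr0n //= /p -opprB powRN invf_lt1 ?powR_gt0 ?ltr0n //.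
  have d1' : 0 < 1 - delta by rewrite subr_gt0.
  have := gt0_ltr_powR d1' (x := 1) (y := n%:R).
  by rewrite powR1 !nnegrE ler01 ltr1n; apply.
have m0 : (0 < m)%N by apply: dvdn_gt0 mn.
apply: prob_GH_ge => //; apply: variance_copies_le => //; first exact: balEH.
  suff -> : (m ^ 2)%:R * p = n%:R `^ (- (1 - delta - 2 * rho)) by [].
  rewrite natrX mE -powR_mulrn ?powR_ge0 // -powRrM /p -powRD ?nR0 ?implybT //.
  by congr (_ `^ _); lra.
suff -> : m%:R * ((p `^ (alpha / 2))^-1 / (n %/ m)%:R) =
    n%:R `^ (- (1 - alpha * (1 - delta) / 2 - 2 * rho)) :> R by [].
(* This is exact because [m] divides [n] and equals [n] to the power [rho]. *)
have -> : (n %/ m)%:R = n%:R `^ (1 - rho) :> R.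
  rewrite powRB ?nR0 ?implybT // powRr1 // -mE -{2}(divnK mn) natrM mulfK //.
  by rewrite pnatr_eq0 -lt0n.
rewrite mE /p -powRrM -!powRN -!powRD ?nR0 ?implybT //.
by congr (_ `^ _); lra.
Qed.
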